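(* Let $n \geq 7$ be an integer, let $S = \{\pm a, \pm b, \pm c\} \subset \mathbb{Z}_n$ be such that $|S| = 6$ and $\langle S \rangle = \mathbb{Z}_n$, and let $\Gamma = \mathrm{Circ}(n; S)$. Suppose that all $j \in \mathcal{A}_n(S)$ are of type 2. Then $\Gamma$ is distance magic if and only if $n$ is odd, $n = 3n_0$ for some integer $n_0 \geq 3$, and at least one of the following holds: (i) there exists $q \in \mathbb{Z}_n^*$ such that $qS = \{\pm 1, \pm (n_0-1), \pm (n_0+1)\}$; (ii) $n_0 = dd'$ for coprime integers $d$ and $d'$ with $1 < d < d'$, both of which are coprime to $3$, and, letting $\delta \in \{-1,1\}$ be such that $n_0 \equiv \delta \pmod 3$ and letting $c' \in \{1,2,\ldots,n-1\}$ be the unique solution of the system $c' \equiv 0 \pmod 3$, $c' \equiv 1 \pmod d$, $c' \equiv -1 \pmod{d'}$, there exists $q \in \mathbb{Z}_n^*$ such that $qS = \{\pm 1, \pm(n_0+\delta), \pm c'\}$.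
   Context: $\mathbb{Z}_n$ is the ring of residue classes modulo $n$ (and its additive cyclic group), $\mathbb{Z}_n^*$ its group of units, $\langle S\rangle$ the additive subgroup generated by $S$, and $qS = \{qs : s \in S\}$. For $S \subset \mathbb{Z}_n$ with $S=-S$ and $0 \notin S$, the circulant $\mathrm{Circ}(n;S)$ is the graph with vertex set $\mathbb{Z}_n$ in which $i,j$ are adjacent iff $j-i \in S$. A graph $\Gamma=(V,E)$ of order $n$ is distance magic if there are a bijection $\ell\colon V \to \{1,\dots,n\}$ and a positive integer $\kappa$ with $\sum_{u \in N(v)} \ell(u) = \kappa$ for all $v \in V$, where $N(v)$ is the set of neighbors of $v$. For $0 \le j \le n-1$ let $\chi_j(x) = e^{2\pi \mathbf{i} jx/n}$ for $x \in \mathbb{Z}_n$ and $\chi_j(S) = \sum_{s\in S}\chi_j(s)$. Put $\mathcal{A}_n(S) = \{ j \in \{0,1,\dots,n-1\} : \chi_j(S) = 0\}$. Type 2: for $S=\{\pm a,\pm b,\pm c\}$ with $|S|=6$ and $j \in \mathcal{A}_n(S)$, let $r_a, r_b, r_c \in [0,1]$ be the unique numbers with $\cos(\pi r_s) = \cos(2\pi js/n)$ for $s \in \{a,b,c\}$, and let $r_1 \le r_2 \le r_3$ be these three numbers in nondecreasing order (so $\cos(r_1\pi)+\cos(r_2\pi)+\cos(r_3\pi)=0$). Then $j$ is of type 2 if $0 \le r_1 \le \frac13$, $r_2 = \frac23 - r_1$, $r_3 = \frac23+r_1$. (A $j$ of type 2 is allowed to be simultaneously of some other type.) *)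

(* Defs.v *)
From HB Require Import structures.
From mathcomp Require Import all_boot all_order all_algebra all_fingroup.
From mathcomp Require Import complex.
From mathcomp Require Import reals trigo.
Set Implicit Arguments.
Unset Strict Implicit.
Unset Printing Implicit Defensive.
Import Order.TTheory GRing.Theory Num.Theory.
Local Open Scope ring_scope.
Local Open Scope complex_scope.

(* A finite simple graph is given by its adjacency relation [e]. *)
Definition distance_magic (V : finType) (e : rel V) : Prop :=
  exists (l : V -> nat) (kappa : nat),
    [/\ injective l,
        forall k : nat, (1 <= k <= #|V|)%N <-> exists v, l v = k,
        (0 < kappa)%N
      & forall v : V, (\sum_(u : V | e v u) l u)%N = kappa].

Definition circ (n : nat) (S : {set 'Z_n}) : rel 'Z_n :=
  fun i j => j - i \in S.

Lemma circ_sym n (S : {set 'Z_n}) :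
  (forall x, (- x \in S) = (x \in S)) -> symmetric (circ S).
Proof. by move=> SN i j; rewrite /circ -SN opprB. Qed.

Lemma circ_irr n (S : {set 'Z_n}) : 0 \notin S -> irreflexive (circ S).
Proof. by move=> S0 i; rewrite /circ subrr; apply: negbTE. Qed.

Definition pm3 (n : nat) (a b c : 'Z_n) : {set 'Z_n} :=
  [set a; - a; b; - b; c; - c].

Definition dilate (n : nat) (q : 'Z_n) (S : {set 'Z_n}) : {set 'Z_n} :=
  [set q * s | s in S].

Section Characters.
Variable R : realType.

Definition expi (t : R) : R[i] := cos t +i* sin t.

(* 2 pi j x / n, with x represented by its residue in {0, ..., n-1} *)
Definition char_angle (n j : nat) (x : 'Z_n) : R :=
  2 * pi * j%:R * (x : nat)%:R / n%:R.

Definition chi (n j : nat) (x : 'Z_n) : R[i] := expi (char_angle j x).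

Definition chi_sum (n j : nat) (S : {set 'Z_n}) : R[i] := \sum_(s in S) chi j s.

Definition vanishing (n : nat) (S : {set 'Z_n}) : {set 'I_n} :=
  [set j : 'I_n | chi_sum j S == 0].

(* cos is injective on [0, pi], so at most one r satisfies this. *)
Definition reduced_angle (n j : nat) (s : 'Z_n) (r : R) : Prop :=
  0 <= r <= 1 /\ cos (pi * r) = cos (char_angle j s).

Definition type2 (n : nat) (a b c : 'Z_n) (j : nat) : Prop :=
  exists ra rb rc r1 r2 r3 : R,
    [/\ reduced_angle j a ra, reduced_angle j b rb & reduced_angle j c rc] /\
    [/\ perm_eq [:: r1; r2; r3] [:: ra; rb; rc], r1 <= r2 & r2 <= r3] /\
    [/\ 0 <= r1 <= 1 / 3, r2 = 2 / 3 - r1 & r3 = 2 / 3 + r1].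

End Characters.

Definition magic_form_i (n n0 : nat) (S : {set 'Z_n}) : Prop :=
  exists2 q : 'Z_n, q \is a GRing.unit
    & dilate q S = pm3 1 (n0%:R - 1) (n0%:R + 1).

Definition magic_form_ii (n n0 : nat) (S : {set 'Z_n}) : Prop :=
  exists d d' : nat,
    [/\ n0 = (d * d')%N, coprime d d', (1 < d < d')%N, coprime d 3
      & coprime d' 3] /\
  exists delta : int,
    [/\ (delta = 1) \/ (delta = -1) & (n0%:Z = delta %[mod 3])%Z] /\
  exists c' : nat,
    [/\ (1 <= c' <= n - 1)%N, (c' = 0 %[mod 3])%N, (c' = 1 %[mod d])%N
      & (c'%:Z = -1 %[mod d'])%Z] /\
  exists2 q : 'Z_n, q \is a GRing.unit
    & dilate q S = pm3 1 (n0%:R + delta%:~R) c'%:R.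

(* Main.v *)
Require Import Defs.
From HB Require Import structures.
From mathcomp Require Import all_boot all_order all_algebra all_fingroup.
From mathcomp Require Import complex.
From mathcomp Require Import reals trigo.
From mathcomp Require Import zify ring lra.
Set Implicit Arguments.
Unset Strict Implicit.
Unset Printing Implicit Defensive.
Import Order.TTheory GRing.Theory Num.Theory.
Local Open Scope ring_scope.

(** The kernel of the adjacency operator of [Circ(n; S)] is spanned by the characters [chi_j] with [chi_j(S) = 0].  If [j] is of type 2 then, for suitable signs, [ja, jb, jc] is an arithmetic progression in [Z_n] whose step has order 3; in particular [3 | n].

    Necessity. Centre the labels.  If [n] is even they are odd integers, and applying [1 + T_h + T_h^2] for [h = a - b] and [h = a + b] annihilates them ([T_h] the shift by [h]), although sums of three odd integers stay odd; so [n] is odd.  Since labels are distinct, no nonzero [p] satisfies [jp = 0] for every vanishing [j].  With [n = 3 n0]: if [3 | n0], all vanishing [j] follow one sign pattern, and [S] is [{t, t + n0, t - n0}] up to sign.  Otherwise one generator, say [c], is [0] mod 3, and after a sign change every [j] satisfies [3j(a - b) = 0] and [3j(a - c) = 0] or [3j(a + c) = 0]; hence [a = b] and [(a - c)(a + c) = 0] mod [n0], with [a] a unit, and the two coprime factors of [n0] are [gcd(a - c, n0)] and [gcd(a + c, n0)].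

    Sufficiency. Labels are assembled from three permutations of [{0, ..., m - 1}] ([m] odd) with constant sum. *)

(** * Fourier transform on [Z_n] *)

Lemma Zp_expr_mod (F : nzRingType) (n : nat) (z : F) (k : nat) :
  (1 < n)%N -> n.-primitive_root z -> z ^+ (k%:R : 'Z_n) = z ^+ k.
Proof. by move=> n1 zP; rewrite val_Zp_nat // (prim_expr_mod zP). Qed.

Lemma Zp_exprD (F : nzRingType) (n : nat) (z : F) (x y : 'Z_n) :
  (1 < n)%N -> n.-primitive_root z -> z ^+ (x + y)%R = z ^+ x * z ^+ y.
Proof.
move=> n1 zP; rewrite -[in LHS](natr_Zp x) -[in LHS](natr_Zp y) -natrD.
by rewrite Zp_expr_mod // exprD.
Qed.

Lemma Zp_exprM (F : nzRingType) (n : nat) (z : F) (x y : 'Z_n) :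
  (1 < n)%N -> n.-primitive_root z -> z ^+ (x * y)%R = z ^+ (x * y)%N.
Proof.
move=> n1 zP; rewrite -[in LHS](natr_Zp x) -[in LHS](natr_Zp y) -natrM.
by rewrite Zp_expr_mod.
Qed.

Lemma Zp_expr_eq1 (F : nzRingType) (n : nat) (z : F) (x : 'Z_n) :
  (1 < n)%N -> n.-primitive_root z -> (z ^+ x == 1) = (x == 0).
Proof.
move=> n1 zP; rewrite -(prim_order_dvd zP) -{2}(natr_Zp x).
by rewrite -val_eqE /= val_Zp_nat.
Qed.

Lemma ltn_Zp (n : nat) (x : 'Z_n) : (1 < n)%N -> (x < n)%N.
Proof. by move=> n1; rewrite -[X in (_ < X)%N]Zp_cast. Qed.

Lemma Zp_exprI (F : nzRingType) (n : nat) (z : F) (x y : 'Z_n) :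
  (1 < n)%N -> n.-primitive_root z -> z ^+ x = z ^+ y -> x = y.
Proof.
move=> n1 zP /eqP; rewrite (eq_prim_root_expr zP) !modn_small ?ltn_Zp //.
by move=> /eqP/val_inj.
Qed.

(** The transform lists the values, at the [n] distinct powers of [z], of the polynomial of degree
    below [n] with coefficients [f x]. *)
Lemma fourier_inj (F : idomainType) (n : nat) (z : F) (f : 'Z_n -> F) :
  (1 < n)%N -> n.-primitive_root z ->
  (forall j : 'Z_n, \sum_x f x * z ^+ (j * x)%R = 0) -> forall x, f x = 0.
Proof.
case: n f => [|[|p]] // f n1 zP f0 x.
pose P := \poly_(i < p.+2) f (inord i).
suff P0 : P = 0.
  by have := congr1 (fun Q : {poly F} => Q`_x) P0; rewrite coef_poly ltn_ord coef0 inord_val.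
apply: (@roots_geq_poly_eq0 _ _ [seq z ^+ (j : nat) | j : 'I_p.+2]).
- apply/allP => _ /mapP[j _ ->]; apply/eqP; rewrite horner_poly -[RHS](f0 j).
  apply: eq_bigr => i _; rewrite inord_val -exprM.
  by rewrite (Zp_exprM (n := p.+2) j i).
- rewrite map_inj_uniq ?enum_uniq // => i j /eqP.
  by rewrite (eq_prim_root_expr zP) !modn_small // => /eqP/val_inj.
- by rewrite size_map -cardT card_ord size_poly.
Qed.

Lemma fourier_shift (F : comNzRingType) (n : nat) (z : F) (f : 'Z_n -> F)
    (j h : 'Z_n) :
  (1 < n)%N -> n.-primitive_root z ->
  \sum_x f (x + h) * z ^+ (j * x)%R
    = z ^+ (- (j * h))%R * \sum_x f x * z ^+ (j * x)%R.
Proof.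
move=> n1 zP; rewrite (reindex_inj (addIr (- h))) big_distrr.
apply: eq_bigr => x _; rewrite subrK [RHS]mulrCA -(Zp_exprD _ _ n1 zP).
by congr (_ * z ^+ nat_of_ord _); ring.
Qed.

Lemma fourier_shifts (F : comNzRingType) (n : nat) (z : F) (f : 'Z_n -> F)
    (j : 'Z_n) (s : seq 'Z_n) :
  (1 < n)%N -> n.-primitive_root z ->
  \sum_x (\sum_(h <- s) f (x + h)) * z ^+ (j * x)%R
    = (\sum_(h <- s) z ^+ (- (j * h))%R) * \sum_x f x * z ^+ (j * x)%R.
Proof.
move=> n1 zP; under eq_bigr do rewrite big_distrl.
by rewrite exchange_big big_distrl; apply: eq_bigr => h _; rewrite fourier_shift.
Qed.

Lemma intr_fun_eq0 (F : numDomainType) (T : Type) (f : T -> int) :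
  (forall x, (f x)%:~R = 0 :> F) -> forall x, f x = 0.
Proof. by move=> f0 x; apply/eqP; rewrite -(intr_eq0 F) f0. Qed.

(** Summation over [S] acts on the transform as multiplication by a character sum, so a kernel
    function has only frequencies at which that sum vanishes. *)
Lemma kernel_support (F : numFieldType) (n : nat) (z : F) (S : {set 'Z_n})
    (f : 'Z_n -> int) (j : 'Z_n) :
  (1 < n)%N -> n.-primitive_root z -> (forall s, (- s \in S) = (s \in S)) ->
  (forall x, \sum_(s in S) f (x + s) = 0) ->
  \sum_(s in S) z ^+ (j * s)%R != 0 ->
  \sum_x (f x)%:~R * z ^+ (j * x)%R = 0.
Proof.
move=> n1 zP SN fS nz.
(* A shift by [s] contributes the exponent [- (j * s)]; since [S = -S], the character sum is
   unchanged. *)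
have {nz} : \sum_(s in S) z ^+ (- (j * s))%R != 0.
  apply: contraNneq nz => {2}<-; rewrite (reindex_inj oppr_inj).
  by apply/eqP/eq_big => s; rewrite ?SN ?mulrN.
move=> nz; apply/eqP; apply: contraTT isT => Fnz.
have /eqP := fourier_shifts (fun x => (f x)%:~R) j (enum S) n1 zP.
rewrite big_enum big1 ?(eq_sym 0) ?mulf_eq0 ?(negPf nz) ?(negPf Fnz) // => x _.
by rewrite big_enum -rmorph_sum fS mul0r.
Qed.

(** At frequency [j], passing from [f x] to [f (x + p) - f x] multiplies the transform by
    [z ^+ (- (j * p)) - 1]; this factor is zero wherever [f] has a frequency. *)
Lemma kernel_periodic (F : numFieldType) (n : nat) (z : F) (S : {set 'Z_n})
    (f : 'Z_n -> int) (p : 'Z_n) :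
  (1 < n)%N -> n.-primitive_root z -> (forall s, (- s \in S) = (s \in S)) ->
  (forall x, \sum_(s in S) f (x + s) = 0) ->
  (forall j : 'Z_n, \sum_(s in S) z ^+ (j * s)%R = 0 -> j * p = 0) ->
  forall x, f (x + p) = f x.
Proof.
move=> n1 zP SN fS jp x; apply/eqP; rewrite -subr_eq0; apply/eqP; move: x.
apply: (@intr_fun_eq0 F); apply: (fourier_inj n1 zP) => j.
under eq_bigr do rewrite rmorphB mulrBl.
rewrite sumrB (fourier_shift (fun x => (f x)%:~R)) //.
have [/eqP/jp-> | nz] := boolP (\sum_(s in S) z ^+ (j * s)%R == 0).
  by rewrite oppr0 expr0 mul1r subrr.
by rewrite (kernel_support n1 zP SN fS nz) mulr0 subrr.
Qed.

(** The operator [1 + T_h + T_h^2]. Its multiplier at [j] is [1 + w + w^2] with [w = z^(-jh)], which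
    is zero when [jh] has order 3. *)
Definition cube_shift (n : nat) (h : 'Z_n) (f : 'Z_n -> int) (x : 'Z_n) : int :=
  f x + f (x + h) + f (x + h + h).

Lemma fourier_cube_shift (F : comNzRingType) (n : nat) (z : F) (h : 'Z_n)
    (f : 'Z_n -> int) (j : 'Z_n) :
  (1 < n)%N -> n.-primitive_root z ->
  \sum_x (cube_shift h f x)%:~R * z ^+ (j * x)%R
    = (1 + z ^+ (- (j * h))%R + z ^+ (- (j * h))%R ^+ 2)
      * \sum_x (f x)%:~R * z ^+ (j * x)%R.
Proof.
move=> n1 zP; under eq_bigr do rewrite !rmorphD !mulrDl.
rewrite !big_split /= !(fourier_shift (fun x => (f x)%:~R)) //.
rewrite (fourier_shift (fun x => (f (x + h))%:~R)) //.
rewrite (fourier_shift (fun x => (f x)%:~R)) //; ring.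
Qed.

(** Composing the two operators covers both alternatives: at each frequency of [f] one of the two
    multipliers is zero. *)
Lemma kernel_cube_shift (F : numFieldType) (n : nat) (z : F) (S : {set 'Z_n})
    (f : 'Z_n -> int) (h h' : 'Z_n) :
  (1 < n)%N -> n.-primitive_root z -> (forall s, (- s \in S) = (s \in S)) ->
  (forall x, \sum_(s in S) f (x + s) = 0) ->
  (forall j : 'Z_n, \sum_(s in S) z ^+ (j * s)%R = 0 ->
     exists u : 'Z_n, [/\ u * 3 = 0, u != 0 & j * h = u \/ j * h' = u]) ->
  forall x, cube_shift h' (cube_shift h f) x = 0.
Proof.
move=> n1 zP SN fS hA; apply: (@intr_fun_eq0 F); apply: (fourier_inj n1 zP) => j.
rewrite !fourier_cube_shift //.
have cube0 (u : 'Z_n) : u * 3 = 0 -> u != 0 ->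
    1 + z ^+ (- u)%R + z ^+ (- u)%R ^+ 2 = 0.
  move=> u3 u0; set w := z ^+ _.
  have w1 : w - 1 != 0 by rewrite subr_eq0 Zp_expr_eq1 // oppr_eq0.
  apply: (mulfI w1); rewrite mulr0.
  have : w ^+ 3 = 1.
    rewrite -exprM; apply/eqP; rewrite -(Zp_expr_mod _ n1 zP) Zp_expr_eq1 //.
    by rewrite natrM natr_Zp mulNr u3 oppr0.
  by move=> w3; transitivity (w ^+ 3 - 1); [ring | rewrite w3 subrr].
have [/eqP/hA[u [u3 u0 [->|->]]] | nz] := boolP (\sum_(s in S) z ^+ (j * s)%R == 0).
- by rewrite (cube0 u) // mul0r mulr0.
- by rewrite (cube0 u) // mul0r.
- by rewrite (kernel_support n1 zP SN fS nz) !mulr0.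
Qed.

(** * Characters of type 2 *)

Section Expi.
Variable R : realType.
Local Open Scope complex_scope.

Lemma expi0 : expi 0 = 1 :> R[i].
Proof. by rewrite /expi cos0 sin0. Qed.

Lemma expiD (x y : R) : expi (x + y) = expi x * expi y.
Proof.
apply/eqP; rewrite eq_complex /= cosD sinD; apply/andP; split; apply/eqP; ring.
Qed.

Lemma expi_neq0 (x : R) : expi x != 0.
Proof.
apply: contraTneq isT => x0; have := oner_neq0 R[i].
by rewrite -expi0 -(subrr x) expiD x0 mul0r eqxx.
Qed.

Lemma expiMn (x : R) k : expi (x *+ k) = expi x ^+ k.
Proof. by elim: k => [|k IHk]; rewrite ?expi0 // mulrS exprS expiD IHk. Qed.

Lemma expi_neq1 (x : R) : 0 < x < pi -> expi (x *+ 2) != 1.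
Proof.
move=> /sin_gt0_pi sx; rewrite eq_complex /= cos_mulr2n cos2sin2 negb_and.
apply/orP; left; apply/eqP => e.
have : sin x ^+ 2 = 0 by lra.
by move/eqP; rewrite sqrf_eq0 gt_eqF.
Qed.

Lemma expi2pi : expi (2 * pi) = 1 :> R[i].
Proof. by rewrite /expi mulr_natl cos2pi sin2pi. Qed.

Lemma expi_prim n : (0 < n)%N -> n.-primitive_root (expi (2 * pi / n%:R) : R[i]).
Proof.
move=> n0; rewrite /primitive_root_of_unity n0; apply/forallP => i.
have nR : 0 < n%:R :> R by rewrite ltr0n.
rewrite unity_rootE -expiMn; apply/eqP.
have [->|ne] := eqVneq i.+1 n.
  have -> : 2 * pi / n%:R *+ n = 2 * pi :> R.
    by rewrite -[LHS]mulr_natr divfK ?gt_eqF.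
  by rewrite expi2pi !eqxx.
have lt_in : (i.+1 < n)%N by rewrite ltn_neqAle ne ltn_ord.
apply/negbTE.
have -> : 2 * pi / n%:R *+ i.+1 = (pi * (i.+1%:R / n%:R)) *+ 2 :> R.
  by rewrite -mulr_natr -[RHS]mulr_natr; ring.
apply: expi_neq1; rewrite mulr_gt0 ?pi_gt0 ?divr_gt0 //=.
by rewrite -[ltRHS]mulr1 ltr_pM2l ?pi_gt0 // ltr_pdivrMr // mul1r ltr_nat.
Qed.

Lemma cos_eq_expi (x y : R) :
  cos x = cos y -> exists e : bool, expi x = expi ((-1) ^+ e * y).
Proof.
move=> cxy; have := sin2cos2 x; rewrite cxy -sin2cos2 => /eqP.
rewrite eqf_sqr => /orP[/eqP s|/eqP s]; [exists false | exists true].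
  by rewrite mul1r /expi cxy s.
by rewrite mulN1r /expi cosN sinN cxy s.
Qed.

Lemma chiE n (j : nat) (x : 'Z_n) :
  chi R j x = expi (2 * pi / n%:R) ^+ (j * x)%N.
Proof.
rewrite -expiMn /chi; congr expi; rewrite -[RHS]mulr_natr natrM /char_angle; ring.
Qed.

End Expi.

(** As [u] has order 3, the powers of a primitive [n]-th root of unity with exponents [ja], [jb],
    [jc] are the vertices of an equilateral triangle. *)
Definition equal_steps (n : nat) (j a b c : 'Z_n) : Prop :=
  exists u, [/\ u * 3 = 0, u != 0, j * a - j * b = u & j * b - j * c = u].

(** A cosine fixes its angle only up to sign, whence one free sign per generator. *)
Definition signed_steps (n : nat) (j a b c : 'Z_n) : Prop :=
  exists e1 e2 e3 : bool,
    equal_steps j ((-1) ^+ e1 * a) ((-1) ^+ e2 * b) ((-1) ^+ e3 * c).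

(** The last term minus the first is [-2u = u], so the progression is cyclic. *)
Lemma signed_steps_rot (n : nat) (j a b c : 'Z_n) :
  signed_steps j a b c -> signed_steps j b c a.
Proof.
case=> e1 [e2 [e3 [u [u3 u0 h1 h2]]]]; exists e2, e3, e1, u; split=> //.
rewrite -(opprK (_ - _)) opprB -(subrKA (j * ((-1) ^+ e2 * b))) h1 h2.
by rewrite -[RHS]subr0 -u3; ring.
Qed.

Lemma signed_steps_swap (n : nat) (j a b c : 'Z_n) :
  signed_steps j a b c -> signed_steps j b a c.
Proof.
case=> e1 [e2 [e3 [u [u3 u0 h1 h2]]]]; exists e2, e1, e3, (- u).
split; rewrite ?oppr_eq0 //; first by rewrite mulNr u3 oppr0.
  by rewrite -h1 opprB.
by rewrite -(subrKA (j * ((-1) ^+ e2 * b))) h1 h2 -[RHS]addr0 -u3; ring.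
Qed.

Section Type2.
Variables (R : realType) (n : nat).
Hypothesis n_gt1 : (1 < n)%N.
Let z : R[i]%C := expi (2 * pi / n%:R).

Let zP : n.-primitive_root z.
Proof. by apply: expi_prim; apply: ltnW. Qed.

Lemma reduced_angle_expi (j : nat) (s : 'Z_n) (r : R) :
  reduced_angle j s r ->
  exists e : bool, expi (pi * r) = z ^+ (j%:R * ((-1) ^+ e * s))%R.
Proof.
case=> _ /cos_eq_expi[e ->]; exists e.
have E : expi (char_angle R j s) = z ^+ (j%:R * s)%R.
  by rewrite -[LHS]/(chi R j s) chiE -{2}(natr_Zp s) -natrM Zp_expr_mod.
case: e; last by rewrite !mul1r.
rewrite !mulN1r mulrN.
apply: (mulfI (expi_neq0 (char_angle R j s))); rewrite -expiD subrr expi0 E.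
by rewrite -Zp_exprD // subrr expr0.
Qed.

(** Adding angles, [t1 + t2] corresponds to [2 pi / 3] and [t2 + t3] to [4 pi / 3]. Negating the
    middle exponent turns both sums into differences with the same cube root of unity [w3]. *)
Lemma reduced_angles_steps (j : nat) (x y w : 'Z_n) (r : R) :
  reduced_angle j x r -> reduced_angle j y (2 / 3 - r) ->
  reduced_angle j w (2 / 3 + r) -> signed_steps j%:R x y w.
Proof.
move=> /reduced_angle_expi[e1 E1] /reduced_angle_expi[e2 E2] /reduced_angle_expi[e3 E3].
have zI (u v : 'Z_n) : z ^+ u = z ^+ v -> u = v by apply: Zp_exprI.
set t1 := (_ * _ : 'Z_n) in E1; set t2 := (_ * _ : 'Z_n) in E2; set t3 := (_ * _ : 'Z_n) in E3.
pose w3 : R[i]%C := expi (2 * pi / 3%:R).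
have w3P : 3.-primitive_root w3 by apply: expi_prim.
have D12 : z ^+ (t1 + t2)%R = w3.
  by rewrite Zp_exprD // -E1 -E2 -expiD; congr expi; field.
have D23 : z ^+ (t2 + t3)%R = w3 ^+ 2.
  by rewrite Zp_exprD // -E2 -E3 -expiD -expiMn; congr expi; rewrite -mulr_natr; field.
have u3 : (t1 + t2) * 3 = 0.
  apply: zI; rewrite expr0 (_ : _ * 3 = (t1 + t2) + (t1 + t2) + (t1 + t2)); last by ring.
  rewrite !(Zp_exprD _ _ n_gt1 zP) -Zp_exprD // D12 -expr2 -exprSr.
  exact: prim_expr_order.
exists e1, (~~ e2), e3, (t1 + t2).
have -> : j%:R * ((-1) ^+ (~~ e2) * y) = - t2.
  by rewrite signrN mulNr mulrN.
split=> //; rewrite ?opprK //.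
  apply: contraTneq isT => u0; have := prim_order_dvd w3P 1.
  by rewrite expr1 -D12 u0 expr0 eqxx.
apply: zI; rewrite D12 -opprD.
apply: (mulfI (expf_neq0 2 (expi_neq0 (2 * pi / 3%:R)))).
rewrite -/w3 -exprSr (prim_expr_order w3P) -D23 -Zp_exprD //.
by rewrite subrr expr0.
Qed.

Lemma reduced_angles_perm_steps (j : nat) (x y w : 'Z_n) (r rx ry rw : R) :
  reduced_angle j x rx -> reduced_angle j y ry -> reduced_angle j w rw ->
  r = rx -> perm_eq [:: r; 2 / 3 - r; 2 / 3 + r] [:: rx; ry; rw] ->
  signed_steps j%:R x y w.
Proof.
move=> Hx Hy Hw E0; move: Hx; rewrite -{rx}E0 perm_cons => Hx P.
have : 2 / 3 - r \in [:: ry; rw] by rewrite -(perm_mem P) mem_head.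
rewrite !inE => /orP[/eqP E|/eqP E].
  move: P; rewrite E perm_cons => /perm_small_eq-/(_ isT)[F].
  by apply: reduced_angles_steps Hx _ _; rewrite ?E ?F.
apply: signed_steps_rot; apply: signed_steps_swap.
move: P; rewrite E perm_sym (perm_catC [:: ry] [:: rw]) perm_cons.
move=> /perm_small_eq-/(_ isT)[F].
by apply: reduced_angles_steps Hx _ _; rewrite ?E -?F.
Qed.

Lemma type2_steps (j : nat) (a b c : 'Z_n) :
  type2 R a b c j -> signed_steps j%:R a b c.
Proof.
case=> ra [rb [rc [r1 [r2 [r3 [[Ha Hb Hc] [[P _ _] [_ e2 e3]]]]]]]].
rewrite {}e2 {}e3 in P.
have : r1 \in [:: ra; rb; rc] by rewrite -(perm_mem P) mem_head.
rewrite !inE => /or3P[/eqP E|/eqP E|/eqP E].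
- exact: reduced_angles_perm_steps Ha Hb Hc E P.
- do 2 apply: signed_steps_rot.
  apply: reduced_angles_perm_steps Hb Hc Ha E _.
  by rewrite perm_sym (perm_catC [:: rb; rc] [:: ra]) perm_sym.
- apply: signed_steps_rot; apply: reduced_angles_perm_steps Hc Ha Hb E _.
  by rewrite perm_sym (perm_catC [:: rc] [:: ra; rb]) perm_sym.
Qed.

End Type2.

(** * Necessity *)

Lemma pm3_rot (n : nat) (a b c : 'Z_n) : pm3 a b c = pm3 b c a.
Proof.
apply/setP => x; rewrite !inE.
by move: (x == a) (x == - a) (x == b) (x == - b) (x == c) (x == - c); do 6!case.
Qed.

Lemma pm3_swap (n : nat) (a b c : 'Z_n) : pm3 a b c = pm3 b a c.
Proof.
apply/setP => x; rewrite !inE.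
by move: (x == a) (x == - a) (x == b) (x == - b) (x == c) (x == - c); do 6!case.
Qed.

Lemma pm3N (n : nat) (a b c : 'Z_n) : pm3 (- a) b c = pm3 a b c.
Proof.
apply/setP => x; rewrite !inE opprK.
by move: (x == a) (x == - a) (x == b) (x == - b) (x == c) (x == - c); do 6!case.
Qed.

Lemma pm3N3 (n : nat) (a b c : 'Z_n) : pm3 a b (- c) = pm3 a b c.
Proof. by rewrite -!(pm3_rot _ a) pm3N. Qed.

Lemma pm3_opp (n : nat) (a b c s : 'Z_n) : (- s \in pm3 a b c) = (s \in pm3 a b c).
Proof.
rewrite !inE !eqr_oppLR !opprK.
by move: (s == a) (s == - a) (s == b) (s == - b) (s == c) (s == - c); do 6!case.
Qed.

Lemma pm3_sign (n : nat) (a b c : 'Z_n) (e e' : bool) :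
  pm3 a ((-1) ^+ e * b) ((-1) ^+ e' * c) = pm3 a b c.
Proof.
rewrite pm3_rot; case: e; rewrite ?mul1r ?mulN1r ?pm3N pm3_rot;
by case: e'; rewrite ?mul1r ?mulN1r ?pm3N pm3_rot.
Qed.

Lemma dilate_pm3 (n : nat) (q a b c : 'Z_n) :
  dilate q (pm3 a b c) = pm3 (q * a) (q * b) (q * c).
Proof. by rewrite /dilate /pm3 !imsetU !imset_set1 !mulrN. Qed.

(* Congruences are expressed inside [Z_n]: [x * N = 0] says [x = 0] mod 3 and [x * 3 = 0] says [x = 0] mod [n0], so [N * N = 0] iff [3 | n0]. *)
Section Torsion.
Variables (n n0 : nat).
Hypotheses (n_gt1 : (1 < n)%N) (n_eq : n = (3 * n0)%N).
Local Notation N := (n0%:R : 'Z_n).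

Lemma Zp_nat_eq0 (k : nat) : ((k%:R : 'Z_n) == 0) = (n %| k)%N.
Proof. by rewrite -val_eqE /= val_Zp_nat. Qed.

Lemma Zp_eq0_dvd (x : 'Z_n) : (x == 0) = (n %| x)%N.
Proof. by rewrite -{1}(natr_Zp x) Zp_nat_eq0. Qed.

Lemma ltn_third : (n0 < n)%N.
Proof. by move: n_gt1 n_eq; lia. Qed.

Lemma mul3N : N * 3 = 0.
Proof. by rewrite -natrM mulnC -n_eq pchar_Zp. Qed.

Lemma N_neq0 : N != 0.
Proof. by rewrite Zp_nat_eq0 n_eq; apply/negP => /dvdn_leq; lia. Qed.

Lemma mulr3_eq0 (x : 'Z_n) : (x * 3 == 0) = (n0 %| x)%N.
Proof.
rewrite -{1}(natr_Zp x) -natrM Zp_nat_eq0.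
have -> : (n %| x * 3)%N = (3 * n0 %| x * 3)%N by rewrite -n_eq.
by rewrite mulnC dvdn_pmul2r.
Qed.

Lemma mulrN_eq0 (x : 'Z_n) : (x * N == 0) = (3 %| x)%N.
Proof.
rewrite -{1}(natr_Zp x) -natrM Zp_nat_eq0.
have -> : (n %| x * n0)%N = (3 * n0 %| x * n0)%N by rewrite -n_eq.
by rewrite dvdn_pmul2r //; move: n_gt1; lia.
Qed.

Lemma torsion3P (x : 'Z_n) : x * 3 = 0 -> [\/ x = 0, x = N | x = - N].
Proof.
move=> /eqP; rewrite mulr3_eq0 => /dvdnP[k xk].
have : (k * n0 < 3 * n0)%N by rewrite -n_eq -xk ltn_Zp.
rewrite ltn_pmul2r; last by move: n_gt1; lia.
have xE : x = k%:R * N by rewrite -natrM -xk natr_Zp.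
case: k xE {xk} => [|[|[|k]]] // -> _.
- by apply: Or31; rewrite mul0r.
- by apply: Or32; rewrite mul1r.
- apply: Or33; rewrite -[RHS]addr0 -mul3N; ring.
Qed.

Lemma torsion3_neq0P (x : 'Z_n) : x * 3 = 0 -> x != 0 -> x = N \/ x = - N.
Proof. by move=> /torsion3P[->|->|->]; rewrite ?eqxx; auto. Qed.

Lemma torsion3_lineP (v x : 'Z_n) :
  v * 3 = 0 -> v != 0 -> x * 3 = 0 -> [\/ x = 0, x = v | x = - v].
Proof.
move=> v3 v0 /torsion3P[->|->|->]; first by apply: Or31.
  by case: (torsion3_neq0P v3 v0) => ->; rewrite ?opprK; [apply: Or32 | apply: Or33].
by case: (torsion3_neq0P v3 v0) => ->; rewrite ?opprK; [apply: Or33 | apply: Or32].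
Qed.

Lemma mulrN_neq0P (x : 'Z_n) : x * N != 0 -> x * N = N \/ x * N = - N.
Proof. by apply: torsion3_neq0P; rewrite -mulrA mul3N mulr0. Qed.

(** Euclid's lemma for the prime 3. *)
Lemma mulrN_eq0_trans (x y : 'Z_n) : x * N != 0 -> x * y * N = 0 -> y * N = 0.
Proof.
move=> /mulrN_neq0P xN; rewrite mulrAC => h.
by case: xN h => ->; rewrite mulrC ?mulrN // => /eqP; rewrite oppr_eq0 => /eqP.
Qed.

End Torsion.

Lemma Zp_odd_mul2 (n : nat) (x : 'Z_n) : (1 < n)%N -> odd n -> x * 2 = 0 -> x = 0.
Proof.
move=> n1 on /eqP; rewrite -{1}(natr_Zp x) -natrM Zp_nat_eq0 // Gauss_dvdl ?coprimen2 //.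
by rewrite -Zp_eq0_dvd // => /eqP.
Qed.

Lemma exists_torsion3_dvd (n : nat) (u : 'Z_n) :
  (1 < n)%N -> u * 3 = 0 -> u != 0 -> (3 %| n)%N.
Proof.
move=> n1 /eqP; rewrite -{1}(natr_Zp u) -natrM Zp_nat_eq0 // Zp_eq0_dvd // => d3.
apply: contraNT; rewrite -prime_coprime // coprime_sym => c3.
by rewrite -(Gauss_dvdl _ c3).
Qed.

(** Multiplication by [b^-1] gives the progression [1 + t, 1, 1 - t], where [t] has order 3 and so
    equals [N] or [-N]. *)
Lemma magic_form_i_steps (n n0 : nat) (a b c : 'Z_n) :
  (1 < n)%N -> n = (3 * n0)%N -> b \is a GRing.unit ->
  (a - b) * 3 = 0 -> a - b != 0 -> b - c = a - b ->
  magic_form_i n0 (pm3 a b c).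
Proof.
move=> n1 n_eq bU s3 s0 cE; exists b^-1; first by rewrite unitrV.
rewrite dilate_pm3 mulVr //.
have [t tE] : exists t, t = b^-1 * (a - b) by eexists.
have -> : b^-1 * a = 1 + t by rewrite tE mulrBr mulVr // addrC subrK.
have -> : b^-1 * c = 1 - t by rewrite tE -cE mulrBr mulVr // opprB addrC subrK.
have t3 : t * 3 = 0 by rewrite tE -mulrA s3 mulr0.
have t0 : t != 0.
  by apply: contraNneq s0 => t0; rewrite -(mulVKr bU (a - b)) -tE t0 mulr0.
rewrite pm3_swap pm3_rot (pm3_rot _ (_ - 1)) -(pm3N (_ - 1)) opprB (addrC n0%:R).
have [->|->] := torsion3_neq0P n1 n_eq t3 t0; last by rewrite opprK.
by rewrite pm3_swap.
Qed.

Lemma signed_steps_norm (n : nat) (j a b c : 'Z_n) :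
  signed_steps j a b c ->
  exists e e' : bool, equal_steps j a ((-1) ^+ e * b) ((-1) ^+ e' * c).
Proof.
case=> e1 [e2 [e3 [u [u3 u0 h1 h2]]]].
exists (e1 (+) e2), (e1 (+) e3), ((-1) ^+ e1 * u).
have s x : x = (-1) ^+ e1 * ((-1) ^+ e1 * x) :> 'Z_n.
  by rewrite mulrA -signr_addb addbb mul1r.
split; rewrite -?mulrA ?u3 ?mulr0 //.
- by apply: contraNneq u0 => u0; rewrite (s u) u0 mulr0.
- by rewrite [in LHS](s a) -h1 signr_addb; ring.
- by rewrite -h2 !signr_addb; ring.
Qed.

(** * Connection sets for which no nonzero [p] is killed by all of [A] *)

Section Classification.
Variables (n n0 : nat).
Hypotheses (n_gt1 : (1 < n)%N) (n_eq : n = (3 * n0)%N) (n_odd : odd n).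
Variable A : {pred 'Z_n}.
Hypothesis A_period : forall p, (forall j, j \in A -> j * p = 0) -> p = 0.
Local Notation N := (n0%:R : 'Z_n).

Lemma exists_A_neq0 (p : 'Z_n) : p != 0 -> exists2 j, j \in A & j * p != 0.
Proof.
move=> p0; apply/exists_inP; apply: contraT; rewrite negb_exists_in => /forall_inP h.
by move: p0; suff -> : p = 0; [rewrite eqxx | apply: A_period => j /h /negPn/eqP].
Qed.

(** Elements of order 3 are here divisible by 3, and 3 does not divide [j0], so the generators agree
    modulo 3. An index with another sign pattern would be divisible by 3 and kill the 3-torsion,
    which [j0] rules out. Hence [a, b, c] is itself a progression whose step has order 3. *)
Lemma classify_NN_eq0_steps (a b c j0 x y z : 'Z_n) :
  N * N = 0 -> x * a + y * b + z * c = 1 ->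
  (forall j, j \in A -> signed_steps j a b c) ->
  j0 * N != 0 -> equal_steps j0 a b c ->
  magic_form_i n0 (pm3 a b c).
Proof.
move=> NN gen hA j0N [u [u3 u0 h1 h2]].
have T := mulrN_eq0_trans n_gt1 n_eq.
have uN : u * N = 0.
  by case: (torsion3_neq0P n_gt1 n_eq u3 u0) => ->; rewrite ?mulNr NN ?oppr0.
have abN : a * N = b * N.
  by apply/eqP; rewrite -subr_eq0 -mulrBl; apply/eqP/(T j0) => //; rewrite mulrBr h1.
have bcN : b * N = c * N.
  by apply/eqP; rewrite -subr_eq0 -mulrBl; apply/eqP/(T j0) => //; rewrite mulrBr h2.
(* If 3 divided [b], it would divide all three generators and hence 1. *)
have bN0 : b * N != 0.
  apply: contraNneq (N_neq0 n_gt1 n_eq) => bN0.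
  have -> : N = (x * a + y * b + z * c) * N by rewrite gen mul1r.
  by rewrite !mulrDl -!mulrA abN -bcN bN0 !mulr0 !addr0.
have jN0 j : j * (b * N) * 2 = 0 -> j * N = 0.
  move=> /(Zp_odd_mul2 n_gt1 n_odd) h; apply: (T b) => //.
  by rewrite (mulrC b) -mulrA.
(* The product [j0 * j * p] is computed in two ways: it is [j * w = 0] because 3 divides [j], and it
   is [j0 * v], which forces 3 to divide [j0]. *)
have no_kill j v p w : j * N = 0 -> v * 3 = 0 -> v != 0 -> j * p = v ->
    w * 3 = 0 -> j0 * p = w -> False.
  move=> jN v3 v0 jp w3 j0p.
  have jw : j * w = 0.
    by case: (torsion3P n_gt1 n_eq w3) => ->; rewrite ?mulrN ?jN ?mulr0 ?oppr0.
  move: j0N; suff -> : j0 * N = 0 by rewrite eqxx.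
  have j0v : j0 * v = 0 by rewrite -jp mulrCA j0p.
  case: (torsion3_neq0P n_gt1 n_eq v3 v0) j0v => -> //.
  by rewrite mulrN => /eqP; rewrite oppr_eq0 => /eqP.
have steps j : j \in A -> exists v, [/\ v * 3 = 0, j * (a - b) = v & j * (b - c) = v].
  case/hA/signed_steps_norm => e [e' [v [v3 v0 k1 k2]]].
  have vN : v * N = 0.
    by case: (torsion3_neq0P n_gt1 n_eq v3 v0) => ->; rewrite ?mulNr NN ?oppr0.
  have k1N : j * (b * N) - (-1) ^+ e * (j * (b * N)) = 0.
    by rewrite -vN -k1 mulrBl -!mulrA abN; ring.
  have k2N : (-1) ^+ e * (j * (b * N)) - (-1) ^+ e' * (j * (b * N)) = 0.
    by rewrite -vN -k2 mulrBl -!mulrA bcN; ring.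
  (* In each mixed pattern 3 divides [j], while [j] sends [b - c], [a - c] or [a - b] to an element
     of order 3. *)
  case: e e' k1 k2 k1N k2N => [] []; rewrite ?mul1r ?mulN1r => k1 k2 k1N k2N.
  - exfalso; apply: (no_kill j (- v) (b - c) u) => //.
    + by apply: jN0; rewrite -k1N; ring.
    + by rewrite mulNr v3 oppr0.
    + by rewrite oppr_eq0.
    + by rewrite -k2; ring.
    + by rewrite mulrBr.
  - exfalso; apply: (no_kill j (- v) (a - c) (- u)) => //.
    + by apply: jN0; rewrite -k1N; ring.
    + by rewrite mulNr v3 oppr0.
    + by rewrite oppr_eq0.
    + rewrite -[RHS]addr0 -v3 (_ : _ + v * 3 = v + v); last by ring.
      by rewrite -{1}k1 -k2; ring.
    + by rewrite mulNr u3 oppr0.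
    + rewrite -[RHS]addr0 -u3 (_ : _ + u * 3 = u + u); last by ring.
      by rewrite -{1}h1 -h2; ring.
  - exfalso; apply: (no_kill j v (a - b) u) => //.
    + by apply: jN0; rewrite -k2N; ring.
    + by rewrite -k1; ring.
    + by rewrite mulrBr.
  - by exists v; rewrite !mulrBr.
have s3 : (a - b) * 3 = 0.
  by apply: A_period => j /steps[v [v3 k1 _]]; rewrite mulrA k1.
have s0 : a - b != 0 by apply: contraNneq u0 => e; rewrite -h1 -mulrBr e mulr0.
have cE : b - c = a - b.
  apply/eqP; rewrite -subr_eq0; apply/eqP/A_period => j /steps[v [_ k1 k2]].
  by rewrite mulrBr k1 k2 subrr.
apply: magic_form_i_steps => //.
have ss : (a - b) * (a - b) = 0.
  by case: (torsion3_neq0P n_gt1 n_eq s3 s0) => ->; rewrite ?mulrNN NN.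
(* The generators agree modulo the square-zero element [a - b], so [(x + y + z) * b] is [1 - k] with
   [k ^+ 2 = 0], and [1 + k] inverts [1 - k]. *)
pose k := (x - z) * (a - b).
apply/unitrPr; exists ((x + y + z) * (1 + k)).
have E : (x + y + z) * b = 1 - k.
  have -> : k = x * (a - b) - z * (b - c) by rewrite cE /k; ring.
  by rewrite -gen; ring.
rewrite mulrA [b * _]mulrC E /k (_ : _ * _ = 1 - (x - z) ^+ 2 * ((a - b) * (a - b))).
  by rewrite ss mulr0 subr0.
by ring.
Qed.

Lemma dilate_comp (q q' : 'Z_n) (S : {set 'Z_n}) :
  dilate q (dilate q' S) = dilate (q * q') S.
Proof. by rewrite /dilate -imset_comp; apply: eq_imset => x /=; rewrite mulrA. Qed.

Lemma magic_forms_dilate (q : 'Z_n) (S : {set 'Z_n}) :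
  q \is a GRing.unit ->
  magic_form_i n0 (dilate q S) \/ magic_form_ii n0 (dilate q S) ->
  magic_form_i n0 S \/ magic_form_ii n0 S.
Proof.
move=> qU [[r rU E]|[d [d' [dP [delta [dl [c' [c'P [r rU E]]]]]]]]].
  by left; exists (r * q); rewrite ?unitrM ?rU // -dilate_comp.
right; exists d, d'; split=> //; exists delta; split=> //; exists c'; split=> //.
by exists (r * q); rewrite ?unitrM ?rU // -dilate_comp.
Qed.

Lemma NN_neq0_dvd : N * N != 0 -> ~~ (3 %| n0)%N.
Proof.
rewrite (mulrN_eq0 n_gt1 n_eq) val_Zp_nat // modn_small //.
exact: (ltn_third n_gt1 n_eq).
Qed.

(** Here [b] is [1] modulo [n0] and [-1] modulo 3. This forces [b = 1 + N] if [n0] is 1 modulo 3 and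
    [b = 1 - N] if it is 2; up to sign both are [n0 + delta]. *)
Lemma magic_form_ii_intro (b c : 'Z_n) (d d' : nat) :
  N * N != 0 -> (b - 1) * 3 = 0 -> b * N = - N -> c * N = 0 ->
  n0 = (d * d')%N -> coprime d d' -> (1 < d < d')%N ->
  (d %| (c - 1)%R)%N -> (d' %| (c + 1)%R)%N ->
  magic_form_ii n0 (pm3 1 b c).
Proof.
move=> NN b3 bN cN n0E cop dd cd cd'.
have n03 := NN_neq0_dvd NN.
have c3 : (3 %| c)%N by rewrite -(mulrN_eq0 n_gt1 n_eq) cN.
have dn : (d %| n)%N by rewrite n_eq n0E mulnCA dvdn_mulr.
have d'n : (d' %| n)%N by rewrite n_eq n0E mulnA dvdn_mull.
have cop3 k : (k %| n0)%N -> coprime k 3.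
  by move=> kn; rewrite coprime_sym prime_coprime //; apply: contra n03 => /dvdn_trans; apply.
exists d, d'; split.
  by split=> //; apply: cop3; rewrite n0E ?(dvdn_mulr _ (dvdnn _)) ?(dvdn_mull _ (dvdnn _)).
have N3 := mul3N n_gt1 n_eq.
have NE : N * N = (n0 %% 3)%:R * N.
  rewrite {1}(divn_eq n0 3) natrD natrM mulrDl -mulrA [3 * N]mulrC N3.
  by rewrite mulr0 add0r.
have N2 : N * 2 <> 0.
  by move=> /(Zp_odd_mul2 n_gt1 n_odd)/eqP; apply/negP/N_neq0.
have bE : b = 1 + N /\ (n0 %% 3 = 1)%N \/ b = 1 - N /\ (n0 %% 3 = 2)%N.
  have bs : b = 1 + (b - 1) by rewrite addrC subrK.
  case: (torsion3P n_gt1 n_eq b3) => e; rewrite e in bs.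
  - by case: N2; move: bN; rewrite bs addr0 mul1r => h; rewrite mulr_natr mulr2n {1}h addNr.
  - left; split=> //; have [//|r2] : (n0 %% 3 = 1)%N \/ (n0 %% 3 = 2)%N by lia.
    have /eqP : N + N * N = - N by rewrite -bN bs mulrDl mul1r.
    rewrite NE r2 (_ : _ + _ = N * 3); last by ring.
    by rewrite N3 eq_sym oppr_eq0 (negPf (N_neq0 n_gt1 n_eq)).
  - right; split=> //; have [r1|//] : (n0 %% 3 = 1)%N \/ (n0 %% 3 = 2)%N by lia.
    rewrite r1 mul1r in NE.
    have /eqP : N - N * N = - N by rewrite -bN bs mulrDl mul1r mulNr.
    by rewrite NE subrr eq_sym oppr_eq0 (negPf (N_neq0 n_gt1 n_eq)).
exists (if (n0 %% 3 == 1)%N then 1 else -1); split.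
  by case: bE => -[_ r]; split; rewrite ?(modz_nat n0 3) r; auto.
have c1 : (c = 1 %[mod d])%N.
  have {1}-> : c = (c - 1)%R.+1%:R :> 'Z_n by rewrite -natr1 natr_Zp subrK.
  by rewrite val_Zp_nat // modn_dvdm // -addn1 -modnDml (eqP cd) add0n.
have c1' : (d' %| c.+1)%N.
  move: cd'; rewrite -{1}(natr_Zp c) natr1 val_Zp_nat //.
  by rewrite /dvdn modn_dvdm.
exists c; split.
  split=> //; last 1 first.
  - apply/eqP; rewrite eqz_mod_dvd opprK (_ : _ + 1 = c.+1%:Z) ?dvdzE //.
    by rewrite [RHS]intS addrC.
  - rewrite leq_subRL ?(ltnW n_gt1) // add1n ltn_Zp // andbT lt0n.
    by apply/eqP => c0; move: c1; rewrite c0 mod0n modn_small //; case/andP: dd.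
  - by rewrite (eqP c3).
exists 1; rewrite ?unitr1 // dilate_pm3 !mul1r natr_Zp.
case: bE => -[-> ->] //=.
  by rewrite (addrC 1).
by rewrite [LHS]pm3_rot -pm3N opprB [RHS]pm3_rot.
Qed.

(** The last hypothesis says that [n0] divides [(c - 1) * (c + 1)]. As [n0] is odd, its gcds with
    the two factors are coprime with product [n0]; form (i) arises when one of them is 1. *)
Lemma magic_forms_normalized (b c : 'Z_n) :
  N * N != 0 -> (b - 1) * 3 = 0 -> b * N = - N -> c * N = 0 ->
  (c - 1) * (c + 1) * 3 = 0 ->
  magic_form_i n0 (pm3 1 b c) \/ magic_form_ii n0 (pm3 1 b c).
Proof.
move=> NN b3 bN cN.
have NnN : N <> - N.
  move=> /eqP; rewrite -subr_eq0 opprK (_ : N + N = N * 2); last by ring.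
  by move=> /eqP/(Zp_odd_mul2 n_gt1 n_odd)/eqP; apply/negP/N_neq0.
have b10 : b - 1 != 0.
  by apply/eqP => /subr0_eq b1; apply: NnN; rewrite -bN b1 mul1r.
(* The elements [b], [1], [e] agree modulo [n0] and are [-1], [1], [0] modulo 3, so they fill a
   coset of the 3-torsion. *)
have form_i e : (e - 1) * 3 = 0 -> e * N = 0 -> magic_form_i n0 (pm3 1 b e).
  move=> e3 eN; rewrite pm3_swap; apply: magic_form_i_steps; rewrite ?unitr1 //.
  have e10 : e - 1 != 0.
    apply: contra_neq (N_neq0 n_gt1 n_eq) => /subr0_eq e1.
    by rewrite -eN e1 mul1r.
  have be : b - 1 != e - 1.
    apply: contra_neq (N_neq0 n_gt1 n_eq) => /addIr be.
    by apply/eqP; rewrite -oppr_eq0 -bN be eN.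
  rewrite -[LHS]opprB; move: b10 e10 be.
  case: (torsion3P n_gt1 n_eq b3) => ->; rewrite ?eqxx //;
  case: (torsion3P n_gt1 n_eq e3) => ->; rewrite ?eqxx ?opprK //.
pose x := (c - 1) : 'Z_n; pose y := (c + 1) : 'Z_n.
rewrite -/x -/y => xy3.
pose d := gcdn x n0; pose d' := gcdn y n0.
have n0_odd : odd n0 by move: n_odd; rewrite n_eq oddM.
have n0n : (n0 %| n)%N by rewrite n_eq dvdn_mull.
have cop : coprime d d'.
  (* A common divisor divides [y - x = 2], and it is odd because [n0] is. *)
  have g2 : (gcdn d d' %| 2)%N.
    have gn : (gcdn d d' %| n)%N.
      by apply: dvdn_trans n0n; apply: dvdn_trans (dvdn_gcdl _ _) (dvdn_gcdr _ _).
    have gx : (gcdn d d' %| x)%N := dvdn_trans (dvdn_gcdl _ _) (dvdn_gcdl _ _).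
    have gy : (gcdn d d' %| y)%N := dvdn_trans (dvdn_gcdr _ _) (dvdn_gcdl _ _).
    rewrite -(dvdn_addr _ gx); move: gy.
    have -> : y = (x + 2)%N%:R.
      by rewrite natrD natr_Zp /x /y -addrA; congr (_ + _); ring.
    by rewrite val_Zp_nat // /dvdn modn_dvdm.
  have g_odd : odd (gcdn d d').
    apply: dvdn_odd n0_odd; exact: dvdn_trans (dvdn_gcdl _ _) (dvdn_gcdr _ _).
  by move: g2 g_odd; rewrite /coprime; case: (gcdn d d') => [|[|[|m]]] // /dvdn_leq; lia.
have dd' : n0 = (d * d')%N.
  apply/eqP; rewrite eqn_dvd (Gauss_dvd _ cop) !dvdn_gcdr andbT.
  rewrite /d /d' muln_gcdr !muln_gcdl !dvdn_gcd (dvdn_mulr y (dvdnn n0)).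
  rewrite !(dvdn_mull _ (dvdnn n0)) !andbT.
  have := mulr3_eq0 n_gt1 n_eq (x * y); rewrite xy3 eqxx => /esym.
  rewrite -{1}(natr_Zp x) -{1}(natr_Zp y) -natrM val_Zp_nat //.
  by rewrite /dvdn modn_dvdm.
have [d1|d1] := eqVneq d 1%N.
  left; rewrite -pm3N3; apply: form_i; last by rewrite mulNr cN oppr0.
  apply/eqP; rewrite -opprD mulNr oppr_eq0 (mulr3_eq0 n_gt1 n_eq).
  by rewrite {1}dd' d1 mul1n dvdn_gcdl.
have [d1'|d1'] := eqVneq d' 1%N.
  left; apply: form_i => //.
  by apply/eqP; rewrite (mulr3_eq0 n_gt1 n_eq) {1}dd' d1' muln1 dvdn_gcdl.
have n0_gt0 : (0 < n0)%N by case: (n0) n0_odd.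
have d_gt1 : (1 < d)%N by rewrite ltn_neqAle eq_sym d1 gcdn_gt0 n0_gt0 orbT.
have d'_gt1 : (1 < d')%N by rewrite ltn_neqAle eq_sym d1' gcdn_gt0 n0_gt0 orbT.
right; case: (ltngtP d d') => [lt_dd'|lt_d'd|eq_dd'].
- by apply: (@magic_form_ii_intro _ _ d d'); rewrite ?dvdn_gcdl ?d_gt1.
(* Replacing [c] by [-c] exchanges the roles of [d] and [d']. *)
- rewrite -pm3N3.
  have dvdN k (v : 'Z_n) : (k %| n)%N -> (k %| v)%N -> (k %| (- v)%R)%N.
    move=> kn kv; rewrite -(dvdn_addr _ kv); apply: dvdn_trans kn _.
    by rewrite -Zp_nat_eq0 // natrD !natr_Zp subrr.
  apply: (@magic_form_ii_intro _ _ d' d) => //.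
  + by rewrite mulNr cN oppr0.
  + by rewrite mulnC.
  + by rewrite coprime_sym.
  + by rewrite d'_gt1.
  + rewrite -opprD; apply: dvdN; rewrite ?dvdn_gcdl //.
    by apply: dvdn_trans n0n; apply: dvdn_gcdr.
  + rewrite addrC -opprB; apply: dvdN; rewrite ?dvdn_gcdl //.
    by apply: dvdn_trans n0n; apply: dvdn_gcdr.
- by move: cop d'_gt1; rewrite eq_dd' /coprime gcdnn => /eqP ->.
Qed.

(** The residues modulo 3 leave only the sign of [c] free, so [3j] kills [a - b] and one of [a - c],
    [a + c]. Then [A_period] gives relations modulo [n0], and dividing by the unit [a] normalizes
    the set. *)
Lemma classify_NN_neq0_core (a b c x y z : 'Z_n) :
  N * N != 0 -> x * a + y * b + z * c = 1 ->
  (forall j, j \in A -> signed_steps j a b c) ->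
  c * N = 0 -> a * N != 0 -> b * N = - (a * N) ->
  magic_form_i n0 (pm3 a b c) \/ magic_form_ii n0 (pm3 a b c).
Proof.
move=> NN gen hA cN aN bN.
have steps j : j \in A ->
    j * (a - b) * 3 = 0 /\ (j * (a - c) * 3 = 0 \/ j * (a + c) * 3 = 0).
  case/hA/signed_steps_norm => e [e' [v [v3 v0 k1 k2]]].
  (* A minus sign at [b] would give [v = j * (a + b)], which is 0 modulo 3, against [N * N != 0]. *)
  case: e k1 k2 => k1 k2.
    case/negP: NN; have /eqP : v * N = 0.
      rewrite -k1 mulN1r mulrN opprK mulrDl -!mulrA bN mulrN subrr //.
    by case: (torsion3_neq0P n_gt1 n_eq v3 v0) => ->; rewrite ?mulNr ?oppr_eq0.
  rewrite mul1r in k1 k2.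
  have k13 : j * (a - b) * 3 = 0 by rewrite mulrBr k1.
  split=> //; case: e' k2 => k2; [right|left].
    rewrite (_ : _ * 3 = (j * a - j * b) * 3 + (j * b - j * ((-1) ^+ true * c)) * 3).
      by rewrite k1 k2 v3 addr0.
    by rewrite expr1; ring.
  rewrite (_ : _ * 3 = (j * a - j * b) * 3 + (j * b - j * ((-1) ^+ false * c)) * 3).
    by rewrite k1 k2 v3 addr0.
  by rewrite expr0; ring.
have ab3 : (a - b) * 3 = 0.
  by apply: A_period => j /steps[k _]; rewrite mulrA.
have ac3 : (a - c) * (a + c) * 3 = 0.
  apply: A_period => j /steps[_ [k|k]].
    by rewrite (_ : _ * _ = j * (a - c) * 3 * (a + c)); [rewrite k mul0r | ring].
  by rewrite (_ : _ * _ = j * (a + c) * 3 * (a - c)); [rewrite k mul0r | ring].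
(* As 3 does not divide [a], multiplication by [a] acts on the 3-torsion as a sign, so all 3-torsion
   consists of multiples of [a]. *)
have Na (t : 'Z_n) : t * 3 = 0 -> exists k, t = a * k.
  move=> t3; case: (mulrN_neq0P n_gt1 n_eq aN) => e;
  case: (torsion3P n_gt1 n_eq t3) => ->.
  - by exists 0; rewrite mulr0.
  - by exists N.
  - by exists (- N); rewrite mulrN e.
  - by exists 0; rewrite mulr0.
  - by exists (- N); rewrite mulrN e opprK.
  - by exists N.
have aU : a \is a GRing.unit.
  have [s sE] := Na _ ab3; have [t tE] := Na _ ac3.
  apply/unitrPr.
  (* The generation identity becomes [w * a + z * c = 1], and [c ^+ 2 = a ^+ 2 - a * t] is a
     multiple of [a]. Expanding [(1 - w * a) ^+ 2 = z ^+ 2 * c ^+ 2] yields the inverse of [a]. *)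
  pose w := x + y - y * s.
  exists (2 * w - w ^+ 2 * a + z ^+ 2 * (a - t)).
  have zc : z * c = 1 - w * a.
    by rewrite -gen /w mulrBl -mulrA [s * a]mulrC -sE; ring.
  rewrite [LHS](_ : _ = 2 * (w * a) - (w * a) ^+ 2 + z ^+ 2 * (a ^+ 2 - a * t)); last by ring.
  rewrite -tE (_ : a ^+ 2 - (a - c) * (a + c) = c ^+ 2); last by ring.
  by rewrite -exprMn zc; ring.
apply: (@magic_forms_dilate a^-1); first by rewrite unitrV.
rewrite dilate_pm3 mulVr //; apply: magic_forms_normalized => //.
- have -> : a^-1 * b - 1 = - (a^-1 * (a - b)) by rewrite mulrBr mulVr // opprB.
  by rewrite mulNr -mulrA ab3 mulr0 oppr0.
- by rewrite -mulrA bN mulrN mulKr.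
- by rewrite -mulrA cN mulr0.
- have -> : a^-1 * c - 1 = - (a^-1 * (a - c)) by rewrite mulrBr mulVr // opprB.
  have -> : a^-1 * c + 1 = a^-1 * (a + c) by rewrite mulrDr mulVr // addrC.
  rewrite [LHS](_ : _ = - (a^-1 * a^-1 * ((a - c) * (a + c) * 3))); last by ring.
  by rewrite ac3 mulr0 oppr0.
Qed.

(** The step [u] is nonzero modulo 3, so [j0] sends the generators to the three distinct residues
    modulo 3: one generator is divisible by 3 and the other two are opposite modulo 3. *)
Lemma classify_NN_neq0_steps (a b c j0 x y z : 'Z_n) :
  N * N != 0 -> x * a + y * b + z * c = 1 ->
  (forall j, j \in A -> signed_steps j a b c) ->
  equal_steps j0 a b c ->
  magic_form_i n0 (pm3 a b c) \/ magic_form_ii n0 (pm3 a b c).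
Proof.
move=> NN gen hA [u [u3 u0 h1 h2]].
have uN : u * N != 0.
  by case: (torsion3_neq0P n_gt1 n_eq u3 u0) => ->; rewrite ?mulNr ?oppr_eq0.
have T (p : 'Z_n) : j0 * p * N = 0 -> p * N = 0.
  apply: (mulrN_eq0_trans n_gt1 n_eq); apply: contraNneq uN => j0N.
  by rewrite -h1 mulrBl ![j0 * _]mulrC -!mulrA j0N !mulr0 subrr.
have uN2 : u * N + u * N = - (u * N).
  have E : u * N + u * N + u * N = u * 3 * N by ring.
  by apply/eqP; rewrite -subr_eq0 opprK E u3 mul0r.
have k1 : j0 * a * N = u * N + j0 * b * N by rewrite -h1; ring.
have k2 : j0 * c * N = j0 * b * N - u * N by rewrite -h2; ring.
have add0 (p q : 'Z_n) : j0 * p * N + j0 * q * N = 0 -> q * N = - (p * N).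
  rewrite -mulrDl -mulrDr => /T; rewrite mulrDl addrC => /eqP.
  by rewrite addr_eq0 => /eqP.
have neq0 (p : 'Z_n) : j0 * p * N = u * N \/ j0 * p * N = - (u * N) -> p * N != 0.
  move=> E; apply: contraNneq uN => p0.
  by case: E; rewrite -mulrA p0 mulr0 => /eqP; rewrite eq_sym ?oppr_eq0.
have uN3 : u * N * 3 = 0 by rewrite -mulrA mul3N ?mulr0.
have b3 : j0 * b * N * 3 = 0 by rewrite -mulrA mul3N ?mulr0.
(* According as [j0 * b] is 0, [u] or [-u] modulo 3, the generator divisible by 3 is [b], [c] or
   [a]. *)
case: (torsion3_lineP n_gt1 n_eq uN3 uN b3) => bE; rewrite bE in k1 k2.
- rewrite addr0 in k1; rewrite sub0r in k2.
  rewrite pm3_swap pm3_rot.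
  apply: (@classify_NN_neq0_core a c b x z y) => //.
  + by rewrite -gen; ring.
  + by move=> j /hA /signed_steps_swap /signed_steps_rot.
  + exact: T.
  + by apply: neq0; left.
  + by apply: add0; rewrite k1 k2 subrr.
- rewrite uN2 in k1; rewrite subrr in k2.
  apply: (@classify_NN_neq0_core a b c x y z) => //.
  + exact: T.
  + by apply: neq0; right.
  + by apply: add0; rewrite k1 bE addNr.
- rewrite subrr in k1; rewrite -opprD uN2 opprK in k2.
  rewrite pm3_rot; apply: (@classify_NN_neq0_core b c a y z x) => //.
  + by rewrite -gen; ring.
  + by move=> j /hA /signed_steps_rot.
  + exact: T.
  + by apply: neq0; right.
  + by apply: add0; rewrite bE k2 addNr.
Qed.

Lemma signed_steps_sign (a b c j : 'Z_n) (e e' : bool) :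
  signed_steps j a b c -> signed_steps j a ((-1) ^+ e * b) ((-1) ^+ e' * c).
Proof.
case=> [e1 [e2 [e3 H]]]; exists e1, (e2 (+) e), (e3 (+) e').
by rewrite !mulrA -!signr_addb -!addbA !addbb !addbF.
Qed.

(** An index [j0] not divisible by 3 fixes the signs; absorbing them into [b] and [c] does not
    change the set. *)
Lemma classify (a b c x y z : 'Z_n) :
  x * a + y * b + z * c = 1 ->
  (forall j, j \in A -> signed_steps j a b c) ->
  magic_form_i n0 (pm3 a b c) \/ magic_form_ii n0 (pm3 a b c).
Proof.
move=> gen hA; have [j0 j0A j0N] := exists_A_neq0 (N_neq0 n_gt1 n_eq).
have [e [e' st]] := signed_steps_norm (hA _ j0A).
rewrite -(pm3_sign a b c e e').
have gen' : x * a + (y * (-1) ^+ e) * ((-1) ^+ e * b)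
    + (z * (-1) ^+ e') * ((-1) ^+ e' * c) = 1.
  by rewrite -[RHS]gen -!mulrA !signrMK.
have hA' j : j \in A -> signed_steps j a ((-1) ^+ e * b) ((-1) ^+ e' * c).
  by move=> /hA; apply: signed_steps_sign.
have [NN|NN] := eqVneq (N * N) 0.
  by left; apply: classify_NN_eq0_steps gen' hA' j0N st.
exact: classify_NN_neq0_steps gen' hA' st.
Qed.

End Classification.

Lemma pm3_generates (n : nat) (a b c : 'Z_n) :
  <<pm3 a b c>>%g = [set: 'Z_n] -> exists x y z, x * a + y * b + z * c = 1.
Proof.
move=> gen; pose P (t : 'Z_n) := exists x y z, x * a + y * b + z * c = t.
rewrite -/(P 1); have : (1%R : 'Z_n) \in <<pm3 a b c>>%g by rewrite gen inE.
case/gen_prodgP => m [g gS ->]; elim/big_ind: _ => [|_ _ [x [y [z <-]]] [x' [y' [z' <-]]]|i _].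
- by exists 0, 0, 0; rewrite !mul0r !addr0.
- exists (x + x'), (y + y'), (z + z').
  rewrite -[RHS]/(x * a + y * b + z * c + (x' * a + y' * b + z' * c)); ring.
- have := gS i; rewrite !inE.
  case/orP => [/orP[/orP[/orP[/orP[]|]|]|]|] /eqP->.
  + by exists 1, 0, 0; ring.
  + by exists (-1), 0, 0; ring.
  + by exists 0, 1, 0; ring.
  + by exists 0, (-1), 0; ring.
  + by exists 0, 0, 1; ring.
  + by exists 0, 0, (-1); ring.
Qed.

(** * Distance magic labellings as kernel functions *)

Lemma sum_labels (V : finType) (l : V -> nat) :
  injective l -> (forall k, (1 <= k <= #|V|)%N <-> exists v, l v = k) ->
  (2 * \sum_v l v = #|V| * #|V|.+1)%N.
Proof.
move=> l_inj lP.
have P : perm_eq [seq l v | v <- index_enum V] (iota 1 #|V|).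
  apply: uniq_perm; rewrite ?iota_uniq ?map_inj_uniq ?index_enum_uniq // => k.
  rewrite mem_iota add1n ltnS; apply/mapP/idP => [[v _ ->]|/lP[v <-]].
    by apply/lP; exists v.
  by exists v; rewrite ?mem_index_enum.
rewrite -(big_map l xpredT id) (perm_big _ P) /=.
elim: #|V| => [|m IHm]; first by rewrite big_nil.
by rewrite -[X in iota _ X]addn1 iotaD big_cat /= big_seq1 mulnDr IHm; lia.
Qed.

Lemma card_Zn (n : nat) : (1 < n)%N -> #|'Z_n| = n.
Proof. by move=> n1; rewrite card_ord Zp_cast. Qed.

Lemma sum_circ_nbrs (W : nmodType) (n : nat) (S : {set 'Z_n}) (l : 'Z_n -> W) (v : 'Z_n) :
  \sum_(u | circ S v u) l u = \sum_(s in S) l (v + s).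
Proof.
rewrite (reindex_inj (addrI v)); apply: eq_bigl => s.
by rewrite /circ addrAC subrr add0r.
Qed.

(** Centring is done as [2 l - (n + 1)], which keeps the values integral and makes their parity that
    of [n + 1]. The total is then 0, and summing the neighbourhood sums over all vertices shows that
    their common value is 0. *)
Lemma distance_magic_kernel (n : nat) (S : {set 'Z_n}) :
  (1 < n)%N -> distance_magic (circ S) ->
  exists f : 'Z_n -> int, [/\ injective f, forall x, exists k, f x = k * 2 - n.+1%:Z
    & forall x, \sum_(s in S) f (x + s) = 0].
Proof.
move=> n1 [l [kappa [l_inj /(sum_labels l_inj) l_sum _ magic]]].
rewrite card_Zn // in l_sum.
pose f x := (l x)%:Z * 2 - n.+1%:Z.
have Posz_sum := big_morph Posz PoszD (erefl 0%:Z).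
have f_sum : \sum_x f x = 0.
  rewrite sumrB -mulr_suml -Posz_sum sumr_const card_Zn //.
  rewrite -[n.+1%:Z *+ n]mulr_natr !natz -!PoszM mulnC l_sum.
  by apply/eqP; rewrite subr_eq0 (mulnC n).
pose K := kappa%:Z * 2 - n.+1%:Z * #|S|%:Z.
have fS x : \sum_(s in S) f (x + s) = K.
  rewrite -(sum_circ_nbrs S f x) sumrB -mulr_suml -Posz_sum magic.
  rewrite (sum_circ_nbrs S (fun=> n.+1%:Z)) sumr_const; congr (_ - _).
  by rewrite -[LHS]mulr_natr natz.
exists f; split=> [x y|x|x]; last 1 first.
- have K0 : K *+ #|'Z_n| = 0.
    rewrite -sumr_const -(eq_bigr _ (fun x _ => fS x)).
    rewrite exchange_big big1 // => s _; rewrite -[RHS]f_sum.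
    by rewrite [RHS](reindex_inj (addIr s)).
  by apply/eqP; rewrite fS; move/eqP: K0; rewrite mulrn_eq0 card_Zn // eqn0Ngt (ltnW n1).
- by rewrite /f => /addIr/mulIf => h; apply: l_inj; have []:= h isT.
- by exists (l x)%:Z.
Qed.

Section Necessity.
Variables (R : realType) (n : nat) (a b c : 'Z_n) (S : {set 'Z_n}).
Hypotheses (n_gt1 : (1 < n)%N) (hS : S = pm3 a b c).
Hypothesis htype : forall j : 'I_n, j \in vanishing R S -> type2 R a b c j.
Let z : R[i]%C := expi (2 * pi / n%:R).

Lemma vanishing_steps (j : 'Z_n) :
  \sum_(s in S) z ^+ (j * s)%R = 0 -> signed_steps j a b c.
Proof.
move=> jS; rewrite -[j]natr_Zp; apply: (@type2_steps R) => //.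
apply: (htype (j := Ordinal (ltn_Zp j n_gt1))); rewrite inE; apply/eqP.
rewrite -[RHS]jS; apply: eq_bigr => s _.
by rewrite chiE (Zp_exprM _ _ n_gt1) //; apply: expi_prim; apply: ltnW.
Qed.

Lemma distance_magic_forms :
  <<S>>%g = [set: 'Z_n] -> distance_magic (circ S) ->
  odd n /\ exists2 n0, n = (3 * n0)%N & magic_form_i n0 S \/ magic_form_ii n0 S.
Proof.
move=> gen /(distance_magic_kernel n_gt1)[f [f_inj f_val fS]].
have zP : n.-primitive_root z by apply: expi_prim; apply: ltnW.
have SN s : (- s \in S) = (s \in S) by rewrite hS pm3_opp.
pose A : {pred 'Z_n} := [pred j : 'Z_n | \sum_(s in S) z ^+ (j * s)%R == 0].
have A_steps j : j \in A -> signed_steps j a b c by move=> /eqP/vanishing_steps.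
(* Such a [p] is a period of the injective function [f]. *)
have A_period p : (forall j, j \in A -> j * p = 0) -> p = 0.
  move=> Ap; apply: (addrI 0); rewrite addr0; apply: f_inj.
  by apply: (kernel_periodic n_gt1 zP SN fS) => j /eqP/Ap.
have n3 : (3 %| n)%N.
  have [j /A_steps[_ [_ [_ [u [u3 u0 _ _]]]]] _] := exists_A_neq0 A_period (oner_neq0 _).
  exact: exists_torsion3_dvd u3 u0.
have n_eq : n = (3 * (n %/ 3))%N by rewrite mulnC divnK.
have n_odd : odd n.
  apply: contraT => n_even.
  have f_odd x : (f x %% 2)%Z = 1 by have [k ->] := f_val x; lia.
  have := @kernel_cube_shift _ n z S f (a - b) (a + b) n_gt1 zP SN fS.
  have c_odd (h : 'Z_n) (g : 'Z_n -> int) : (forall x, (g x %% 2)%Z = 1) ->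
      forall x, (cube_shift h g x %% 2)%Z = 1.
    move=> g_odd x; rewrite /cube_shift.
    by have := g_odd x; have := g_odd (x + h); have := g_odd (x + h + h); lia.
  move=> ker; have := c_odd (a + b) _ (c_odd (a - b) f f_odd) 0.
  rewrite ker // => j jS.
  (* The sign of [b] decides whether [j] sends [a - b] or [a + b] to [u]. *)
  have /signed_steps_norm[e [_ [u [u3 u0 ju _]]]] := vanishing_steps jS.
  exists u; split=> //; case: e ju; rewrite ?mul1r ?mulN1r => <-; [right | left]; ring.
split=> //; exists (n %/ 3)%N => //.
have := gen; rewrite hS => /pm3_generates[x [y [w gen1]]].
exact: (classify n_gt1 n_eq n_odd A_period gen1 A_steps).
Qed.

End Necessity.

(** * Sufficiency *)

Lemma card_dilate (n : nat) (q : 'Z_n) (S : {set 'Z_n}) :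
  q \is a GRing.unit -> #|dilate q S| = #|S|.
Proof. by move=> qU; apply: card_imset; apply: mulrI. Qed.

(** Multiplication by [q] carries the graph to that of the dilated set. Labels from 0 to [n - 1]
    suffice, because adding 1 to each raises every neighbourhood sum by [#|S|]. *)
Lemma distance_magic_dilate (n K : nat) (q : 'Z_n) (S : {set 'Z_n}) (L : 'Z_n -> nat) :
  (1 < n)%N -> q \is a GRing.unit -> (0 < #|S|)%N -> injective L ->
  (forall y, L y < n)%N ->
  (forall y, (\sum_(t in dilate q S) L (y + t)%R)%N = K) ->
  distance_magic (circ S).
Proof.
move=> n1 qU S0 L_inj L_lt LK.
have qI := mulrI qU.
exists (fun x => (L (q * x)).+1), (K + #|S|)%N; split.
- by move=> x y [/L_inj/qI].
- move=> k; rewrite card_Zn //; split=> [/andP[k0 kn]|[v <-]]; last by rewrite L_lt.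
  have kn' : (k.-1 < n)%N by rewrite prednK.
  pose L' x : 'I_n := Ordinal (L_lt (q * x)).
  have L'_inj : injective L' by move=> x y [/L_inj/qI].
  have [g _ gK] : bijective L' by apply: inj_card_bij; rewrite // card_Zn ?card_ord.
  exists (g (Ordinal kn')); have := congr1 (@nat_of_ord n) (gK (Ordinal kn')).
  by rewrite /= => ->; rewrite prednK.
- by rewrite addn_gt0 S0 orbT.
- move=> v; rewrite -(LK (q * v)) /dilate big_imset /=; last by move=> x y _ _ /qI.
  rewrite -[#|S|]sum1_card -big_split /=.
  rewrite (reindex_inj (addrI v)); apply: eq_big => s.
    by rewrite /circ addrAC subrr add0r.
  by rewrite mulrDr addn1.
Qed.

Lemma sum_pm3 (n : nat) (a b c : 'Z_n) (F : 'Z_n -> nat) :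
  #|pm3 a b c| = 6%N ->
  (\sum_(s in pm3 a b c) F s
    = F a + F (- a)%R + F b + F (- b)%R + F c + F (- c)%R)%N.
Proof.
pose s := [:: a; - a; b; - b; c; - c].
have sE : pm3 a b c =i s by move=> x; rewrite !inE -!orbA.
move=> card6; have s_uniq : uniq s by apply/card_uniqP; rewrite -(eq_card sE) card6.
rewrite (eq_bigl _ _ sE) -big_uniq //= !big_cons big_nil.
by rewrite addn0 !addnA.
Qed.

(* For odd [m] the three rows [u = 0, 1, 2] are permutations of [{0, ..., m - 1}] with constant column sums. *)
Definition magic_row (m u i : nat) : nat :=
  if u == 0%N then i
  else if u == 1%N then ((i + m./2) %% m)%N
  else (3 * m./2 - i - (i + m./2) %% m)%N.

Section MagicRow.
Variable m : nat.
Hypothesis m_odd : odd m.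

(** With [m = 2h + 1], adding [i] gives [h, h + 2, ..., 3h] for [i <= h] and
    [h + 1, h + 3, ..., 3h - 1] otherwise. Each value from [h] to [3h] occurs once, so row 2 of
    [magic_row] is a permutation and its subtractions never truncate. *)
Lemma half_shift (i : nat) : (i < m)%N ->
  ((i + m./2) %% m = if i <= m./2 then i + m./2 else i - m./2.+1)%N.
Proof.
have := odd_double_half m; rewrite m_odd add1n -muln2 => mE im.
case: (leqP i m./2) => h; first by rewrite modn_small //; lia.
have -> : (i + m./2 = i - m./2.+1 + m)%N by lia.
by rewrite modnDr modn_small //; lia.
Qed.

Lemma magic_row_lt (u i : nat) : (i < m)%N -> (magic_row m u i < m)%N.
Proof.
have := odd_double_half m; rewrite m_odd add1n -muln2 => mE im.
rewrite /magic_row half_shift //; case: eqP => // _; case: eqP => _; case: (leqP i m./2); lia.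
Qed.

Lemma magic_row_inj (u i j : nat) : (i < m)%N -> (j < m)%N ->
  magic_row m u i = magic_row m u j -> i = j.
Proof.
have := odd_double_half m; rewrite m_odd => mE im jm.
rewrite /magic_row !half_shift //; case: eqP => // _; case: eqP => _;
case: (leqP i m./2); case: (leqP j m./2); lia.
Qed.

Lemma magic_row_sum (i : nat) : (i < m)%N ->
  (magic_row m 0 i + magic_row m 1 i + magic_row m 2 i = 3 * m./2)%N.
Proof.
have := odd_double_half m; rewrite m_odd add1n -muln2 => mE im.
rewrite /magic_row /= half_shift //; case: (leqP i m./2); lia.
Qed.

(** The three arguments lie in one column, and their residues modulo 3 select each row once. *)
Lemma magic_row_sum_mod (k1 k2 k3 : nat) :
  (k1 = k2 %[mod m])%N -> (k1 = k3 %[mod m])%N ->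
  uniq [:: k1 %% 3; k2 %% 3; k3 %% 3]%N ->
  (magic_row m (k1 %% 3) (k1 %% m) + magic_row m (k2 %% 3) (k2 %% m)
    + magic_row m (k3 %% 3) (k3 %% m) = 3 * m./2)%N.
Proof.
move=> <- <-; have i_lt : (k1 %% m < m)%N by rewrite ltn_mod; case: (m) m_odd.
rewrite -(magic_row_sum i_lt); move: (k1 %% m)%N => i.
have := ltn_pmod k1 (isT : 0 < 3)%N; have := ltn_pmod k2 (isT : 0 < 3)%N.
have := ltn_pmod k3 (isT : 0 < 3)%N.
move: (k1 %% 3)%N (k2 %% 3)%N (k3 %% 3)%N.
by move=> [|[|[|u1]]] [|[|[|u2]]] [|[|[|u3]]] //= _ _ _ _; rewrite -/(magic_row m 0 i); lia.
Qed.

End MagicRow.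

(** Writing [y = i + u * n0] places [y] in column [i] and row [u], so a coset of the subgroup of
    order 3 is a column. Each neighbourhood is, after dilation, the union of the cosets of [y + 1]
    and [y - 1]. *)
Lemma magic_form_i_distance_magic (n n0 : nat) (S : {set 'Z_n}) :
  (1 < n)%N -> n = (3 * n0)%N -> odd n -> #|S| = 6%N ->
  magic_form_i n0 S -> distance_magic (circ S).
Proof.
move=> n1 n_eq n_odd card6 [q qU qS].
have n0_odd : odd n0 by move: n_odd; rewrite n_eq oddM.
have n0_gt0 : (0 < n0)%N by case: (n0) n0_odd.
pose L (y : 'Z_n) := (3 * magic_row n0 (y %/ n0) (y %% n0) + y %/ n0)%N.
have i_lt (k : nat) : (k %% n0 < n0)%N by rewrite ltn_mod.
have u_lt (y : 'Z_n) : (y %/ n0 < 3)%N by rewrite ltn_divLR // -n_eq ltn_Zp.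
have LE (i u : nat) : (i < n0)%N ->
    L (i + u * n0)%N%:R = (3 * magic_row n0 (u %% 3) i + u %% 3)%N.
  move=> i_n0; rewrite /L val_Zp_nat //.
  have -> : ((i + u * n0) %% n = u %% 3 * n0 + i)%N.
    rewrite {1}(divn_eq u 3) mulnDl addnCA -mulnA -n_eq modnMDl modn_small addnC //.
    by rewrite n_eq; have := ltn_pmod u (isT : 0 < 3)%N; nia.
  by rewrite divnMDl // (divn_small i_n0) addn0 modnMDl (modn_small i_n0).
(* Three times the column sum [3 * n0./2], plus the row numbers [0 + 1 + 2]. *)
pose K := (3 * (3 * n0./2) + 3)%N.
have coset (y : 'Z_n) : (L y + L (y + n0%:R)%R + L (y - n0%:R)%R = K)%N.
  have yE : y = (y %% n0 + y %/ n0 * n0)%N%:R by rewrite addnC -divn_eq natr_Zp.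
  have -> : y + n0%:R = (y %% n0 + (y %/ n0).+1 * n0)%N%:R.
    by rewrite {1}yE -natrD mulSn [(n0 + _)%N]addnC addnA.
  have -> : y - n0%:R = (y %% n0 + (y %/ n0).+2 * n0)%N%:R.
    rewrite {1}yE !mulSn !natrD !natrM -[LHS]addr0 -(mul3N n1 n_eq); ring.
  rewrite {1}yE !LE // /K -(magic_row_sum n0_odd (i_lt y)).
  have := u_lt y; case: (y %/ n0)%N => [|[|[|]]] // _.
  - by rewrite (_ : 0 %% 3 = 0)%N // (_ : 2 %% 3 = 2)%N // (_ : 1 %% 3 = 1)%N //; lia.
  - by rewrite (_ : 3 %% 3 = 0)%N // (_ : 2 %% 3 = 2)%N // (_ : 1 %% 3 = 1)%N //; lia.
  - by rewrite (_ : 3 %% 3 = 0)%N // (_ : 2 %% 3 = 2)%N // (_ : 4 %% 3 = 1)%N //; lia.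
apply: (@distance_magic_dilate n (K + K) q S L) => //; rewrite ?card6 //.
- move=> x y E; apply: val_inj => /=.
  rewrite (divn_eq x n0) (divn_eq y n0).
  have [e1 e2] : (x %/ n0)%N = (y %/ n0)%N /\
     magic_row n0 (x %/ n0) (x %% n0) = magic_row n0 (y %/ n0) (y %% n0).
    move: E (u_lt x) (u_lt y); rewrite /L.
    move: (magic_row n0 (x %/ n0)%N (x %% n0)%N) (magic_row n0 (y %/ n0)%N (y %% n0)%N).
    by move: (x %/ n0)%N (y %/ n0)%N; lia.
  by rewrite e1 in e2 *; rewrite (magic_row_inj n0_odd (i_lt x) (i_lt y) e2).
- move=> y; have := magic_row_lt n0_odd (y %/ n0) (i_lt y); have := u_lt y.
  rewrite /L => hu hm; apply: (@leq_trans (3 * n0)%N); last by rewrite -n_eq.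
  by move: hu hm; move: (magic_row n0 (y %/ n0)%N (y %% n0)%N) (y %/ n0)%N; lia.
move=> y; have c6 := card_dilate S qU; rewrite card6 qS in c6.
rewrite qS sum_pm3 // -{1}(coset (y + 1)) -(coset (y - 1)).
have -> : y + 1 + n0%:R = y + (n0%:R + 1) by ring.
have -> : y + 1 - n0%:R = y - (n0%:R - 1) by ring.
have -> : y - 1 + n0%:R = y + (n0%:R - 1) by ring.
have -> : y - 1 - n0%:R = y - (n0%:R + 1) by ring.
move: (L (y + 1)) (L (y - 1)) (L (y + (n0%:R - 1))) (L (y - (n0%:R - 1))).
by move: (L (y + (n0%:R + 1))) (L (y - (n0%:R + 1))); lia.
Qed.

(** * Labellings for form (ii) *)

Lemma uniq_modDl (m y k1 k2 k3 : nat) :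
  uniq [:: (y + k1) %% m; (y + k2) %% m; (y + k3) %% m]%N
    = uniq [:: k1 %% m; k2 %% m; k3 %% m]%N.
Proof. by rewrite /= !inE !eqn_modDl. Qed.

Lemma sum_uniq_mod3 (k1 k2 k3 : nat) :
  uniq [:: k1 %% 3; k2 %% 3; k3 %% 3]%N -> (k1 %% 3 + k2 %% 3 + k3 %% 3 = 3)%N.
Proof.
have := ltn_pmod k1 (isT : 0 < 3)%N; have := ltn_pmod k2 (isT : 0 < 3)%N.
have := ltn_pmod k3 (isT : 0 < 3)%N.
move: (k1 %% 3)%N (k2 %% 3)%N (k3 %% 3)%N.
by move=> [|[|[|u1]]] [|[|[|u2]]] [|[|[|u3]]].
Qed.

(** Labels are mixed-radix numbers with digits taken from [k] modulo 3, [d] and [d']. The elements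
    [1, B, c'] agree modulo [d], and [1, B, -c'] agree modulo [d']; each triple meets all residues
    modulo 3. So the low part [r] and the high part are balanced by two different splittings of the
    same six neighbours. *)
Lemma magic_form_ii_distance_magic (n n0 : nat) (S : {set 'Z_n}) :
  (1 < n)%N -> n = (3 * n0)%N -> odd n -> #|S| = 6%N ->
  magic_form_ii n0 S -> distance_magic (circ S).
Proof.
have lin3 (p A B C u v w : nat) :
    (p * A + u + (p * B + v) + (p * C + w) = p * (A + B + C) + (u + v + w))%N.
  by rewrite !mulnDr; lia.
(* The low parts are grouped by positions 1, 3, 5 and 2, 4, 6, the high parts by 1, 3, 6 and 2, 4,
   5. *)
have lin6 (p a1 a2 a3 a4 a5 a6 g1 g2 g3 g4 g5 g6 X Y : nat) :
    (a1 + a3 + a5 = X -> a2 + a4 + a6 = X -> g1 + g3 + g6 = Y -> g2 + g4 + g5 = Y ->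
    a1 + p * g1 + (a2 + p * g2) + (a3 + p * g3) + (a4 + p * g4) + (a5 + p * g5)
      + (a6 + p * g6) = 2 * X + p * (2 * Y))%N.
  move=> <- e2 <- e4; rewrite mul2n -addnn -{2}e2 mul2n -addnn -{2}e4 !mulnDr; lia.
move=> n1 n_eq n_odd card6 [d [d' [[n0E cop dd' d3 d'3]]]].
case=> delta [[deltaE delta3]] [c' [[_ c3 cd cd'] [q qU qS]]].
have n0_odd : odd n0 by move: n_odd; rewrite n_eq oddM.
have d_odd : odd d by move: n0_odd; rewrite n0E oddM => /andP[].
have d'_odd : odd d' by move: n0_odd; rewrite n0E oddM => /andP[].
have n_dd' : n = (3 * d * d')%N by rewrite n_eq n0E mulnA.
have [d_gt0 d'_gt0] : (0 < d)%N /\ (0 < d')%N by case/andP: dd'; lia.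
have dn : (d %| n)%N by rewrite n_dd' mulnAC dvdn_mull.
have d'n : (d' %| n)%N by rewrite n_dd' dvdn_mull.
have n3 : (3 %| n)%N by rewrite n_eq dvdn_mulr.
pose r k := (3 * magic_row d (k %% 3) (k %% d) + k %% 3)%N.
pose L k := (r k + 3 * d * magic_row d' (k %% 3) (k %% d'))%N.
have L_mod k : L (k %% n)%N = L k by rewrite /L /r !modn_dvdm.
have r_lt k : (r k < 3 * d)%N.
  rewrite /r; have := magic_row_lt d_odd (k %% 3) (ltn_pmod k d_gt0).
  have := ltn_pmod k (isT : 0 < 3)%N.
  by move: (magic_row d (k %% 3)%N (k %% d)%N) (k %% 3)%N; lia.
(* [B] represents [delta * (n0 + delta)], and [M] represents [-1]. *)
pose B := (1 + (if delta == 1 then 1 else 2) * n0)%N.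
pose M := (n - 1)%N.
have BE : pm3 1 (n0%:R + delta%:~R) c'%:R = pm3 1 B%:R c'%:R :> {set 'Z_n}.
  case: deltaE => dE; rewrite /B dE /= natrD ?mul1n; first by rewrite addrC.
  rewrite pm3_rot -pm3N -pm3_rot; congr pm3.
  rewrite opprD opprK natrM -[LHS]addr0 -(mul3N n1 n_eq); ring.
have B3 : (B %% 3 = 2)%N.
  by rewrite /B; case: deltaE delta3 => -> /=; lia.
have MN k : - (k%:R) = (M * k)%N%:R :> 'Z_n.
  by rewrite natrM /M natrB ?(ltnW n1) // pchar_Zp // sub0r mulN1r.
have M3 : (M %% 3 = 2)%N by rewrite /M; move: n3 n1; lia.
have Bd k : (k %| n0)%N -> (B = 1 %[mod k])%N.
  by move=> kn; rewrite /B -modnDmr -modnMmr (eqP kn) muln0 mod0n addn0.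
have c'd' : (d' %| c' + 1)%N.
  have /eqP : (c'%:Z = -1 %[mod d'])%Z by [].
  by rewrite eqz_mod_dvd opprK dvdzE.
have MS : (M + 1 = n)%N by rewrite /M subnK // ltnW.
have M1d' : (M * 1 = c' %[mod d'])%N.
  by apply/eqP; rewrite muln1 -(eqn_modDr 1) MS (eqP d'n) (eqP c'd').
have Md' : (M * c' = 1 %[mod d'])%N.
  apply/eqP; rewrite -(eqn_modDr c') (addnC 1) (eqP c'd').
  by rewrite -[X in (_ + X)%N]mul1n -mulnDl MS -modnMml (eqP d'n) mul0n mod0n.
have MM k k1 k2 : (k1 = k2 %[mod k] -> M * k1 = M * k2 %[mod k])%N.
  by move=> e; rewrite -modnMmr e modnMmr.
have DD y k k1 k2 : (k1 = k2 %[mod k] -> y + k1 = y + k2 %[mod k])%N.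
  by move=> e; rewrite -modnDmr e modnDmr.
pose g k := magic_row d' (k %% 3) (k %% d').
have sum_d y k1 k2 k3 : (k1 = k2 %[mod d])%N -> (k1 = k3 %[mod d])%N ->
    uniq [:: k1 %% 3; k2 %% 3; k3 %% 3]%N ->
    (r (y + k1) + r (y + k2) + r (y + k3) = 9 * d./2 + 3)%N.
  move=> e2 e3; rewrite -(uniq_modDl _ y) => u3; have := sum_uniq_mod3 u3.
  have := magic_row_sum_mod d_odd (DD y _ _ _ e2) (DD y _ _ _ e3) u3; rewrite /r.
  by move=> h1 h2; rewrite lin3 h1 h2 mulnA.
have sum_d' y k1 k2 k3 : (k1 = k2 %[mod d'])%N -> (k1 = k3 %[mod d'])%N ->
    uniq [:: k1 %% 3; k2 %% 3; k3 %% 3]%N ->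
    (g (y + k1) + g (y + k2) + g (y + k3) = 3 * d'./2)%N.
  move=> e2 e3; rewrite -(uniq_modDl _ y).
  exact: (magic_row_sum_mod d'_odd (DD y _ _ _ e2) (DD y _ _ _ e3)).
pose K := (2 * (9 * d./2 + 3) + 3 * d * (2 * (3 * d'./2)))%N.
have MB3 : (M * B %% 3 = 1)%N by rewrite -modnMml -modnMmr M3 B3.
have Mc3 : (M * c' %% 3 = 0)%N by rewrite -modnMmr c3 mod0n muln0.
have M13 : (M * 1 %% 3 = 2)%N by rewrite muln1.
have six (y : nat) : (L (y + 1) + L (y + M * 1) + L (y + B) + L (y + M * B)
    + L (y + c') + L (y + M * c') = K)%N.
  have Bdd : (B = 1 %[mod d])%N by apply: Bd; rewrite n0E dvdn_mulr.
  have Bdd' : (B = 1 %[mod d'])%N by apply: Bd; rewrite n0E dvdn_mull.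
  have s1 := @sum_d y 1%N B c' (esym Bdd) (esym cd).
  have s2 := @sum_d y (M * 1)%N (M * B)%N (M * c')%N (MM _ _ _ (esym Bdd)) (MM _ _ _ (esym cd)).
  have s3 := @sum_d' y 1%N B (M * c')%N (esym Bdd') (esym Md').
  have s4 := @sum_d' y (M * 1)%N (M * B)%N c' (MM _ _ _ (esym Bdd')) M1d'.
  rewrite B3 c3 in s1; rewrite M13 MB3 Mc3 in s2.
  rewrite B3 Mc3 in s3; rewrite M13 MB3 c3 in s4.
  exact: (lin6 _ _ _ _ _ _ _ _ _ _ _ _ _ _ _ (s1 isT) (s2 isT) (s3 isT) (s4 isT)).
have crt (i j : nat) : (i = j %[mod 3] -> i = j %[mod d] -> i = j %[mod d'] ->
    i = j %[mod n])%N.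
  move=> e3 ed ed'; apply/eqP.
  rewrite n_dd' chinese_remainder ?coprimeMl; last by rewrite coprime_sym d'3 cop.
  by rewrite chinese_remainder ?e3 ?ed ?ed' ?eqxx // coprime_sym.
have valD (y : 'Z_n) k : L (y + k%:R) = L (y + k)%N.
  by rewrite -{1}(natr_Zp y) -natrD val_Zp_nat // L_mod.
apply: (@distance_magic_dilate n K q S (fun y => L y)) => //; rewrite ?card6 //.
- move=> x y E; apply: val_inj => /=.
  have Q k : (L k = magic_row d' (k %% 3) (k %% d') * (3 * d) + r k)%N.
    by rewrite /L addnC mulnC.
  have p_gt0 : (0 < 3 * d)%N by rewrite muln_gt0.
  move: E; rewrite !Q => E.
  (* The digits are read off in turn: [r] is the label modulo [3 * d], its residue modulo 3 selects
     the row, and injectivity of the rows recovers the residues modulo [d] and [d']. *)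
  have rE : r x = r y.
    by have := congr1 (modn^~ (3 * d)%N) E; rewrite !modnMDl !modn_small.
  have gE : magic_row d' (x %% 3) (x %% d') = magic_row d' (y %% 3) (y %% d').
    have := congr1 (divn^~ (3 * d)%N) E; rewrite !divnMDl //.
    by rewrite !divn_small // !addn0.
  have e3 : (x = y %[mod 3])%N.
    have := congr1 (modn^~ 3%N) rE; rewrite /r ![(3 * magic_row _ _ _)%N]mulnC.
    by rewrite !modnMDl !modn_mod.
  have ed : (x = y %[mod d])%N.
    apply: (magic_row_inj d_odd (u := (x %% 3)%N)); rewrite ?ltn_mod //.
    by move: rE; rewrite /r e3 => /addIn/eqP; rewrite eqn_pmul2l // => /eqP.
  have ed' : (x = y %[mod d'])%N.
    by apply: (magic_row_inj d'_odd (u := (x %% 3)%N)); rewrite ?ltn_mod // gE e3.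
  by have := crt _ _ e3 ed ed'; rewrite !modn_small ?ltn_Zp.
- move=> y; apply: (@leq_trans (3 * d * d')%N); last by rewrite -n_dd'.
  have := magic_row_lt d'_odd (y %% 3) (ltn_pmod y d'_gt0) => lt.
  apply: (@leq_trans (3 * d * (magic_row d' (y %% 3) (y %% d')).+1)%N).
    by rewrite mulnS ltn_add2r r_lt.
  by rewrite leq_mul2l lt orbT.
have c6 := card_dilate S qU; rewrite card6 qS BE in c6.
move=> y; rewrite qS BE sum_pm3 // -(mulr1n 1) !MN !valD; exact: six.
Qed.

Theorem theorem5p5 (R : realType) (n : nat) (hn : (7 <= n)%N)
    (a b c : 'Z_n) (S : {set 'Z_n}) (hS : S = pm3 a b c)
    (hcard : #|S| = 6%N) (hgen : <<S>>%g = [set: 'Z_n])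
    (htype : forall j : 'I_n, j \in vanishing R S -> type2 R a b c j) :
  distance_magic (circ S) <->
    odd n /\
    exists n0 : nat,
      [/\ (3 <= n0)%N, n = (3 * n0)%N
        & magic_form_i n0 S \/ magic_form_ii n0 S].
Proof.
have n1 : (1 < n)%N by apply: leq_trans hn.
split=> [/(distance_magic_forms n1 hS htype hgen)[n_odd [n0 n_eq forms]]|].
  split=> //; exists n0; split=> //; move: hn; rewrite [X in (_ <= X)%N]n_eq.
  by case: (n0) => [|[|[|m]]].
case=> n_odd [n0 [_ n_eq [form|form]]].
  exact: magic_form_i_distance_magic form.
exact: magic_form_ii_distance_magic form.
Qed.
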